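(* For every $\epsilon>0$ there exists a constant $C_\epsilon>0$, depending only on $\epsilon$, such that for every squarefree positive integer $N$ and every function $f:(\mathbb{Z}/N\mathbb{Z})^2\to\mathbb{C}$ whose Fourier transform $\widehat{f}$ is supported in the parabola $\Sigma=\{(t,t^2):t\in\mathbb{Z}/N\mathbb{Z}\}$ (i.e. $\widehat f(m)=0$ for $m\notin\Sigma$), $$\left(\frac{1}{N^2}\sum_{x\in(\mathbb{Z}/N\mathbb{Z})^2}|f(x)|^4\right)^{\frac14}\leq C_\epsilon N^\epsilon\left(\frac{1}{N^2}\sum_{x\in(\mathbb{Z}/N\mathbb{Z})^2}|f(x)|^2\right)^{\frac12}.$$
   Context: The Fourier transform of $f:(\mathbb{Z}/N\mathbb{Z})^2\to\mathbb{C}$ is normalized by $\widehat{f}(m)=N^{-1}\sum_{x\in(\mathbb{Z}/N\mathbb{Z})^2}f(x)e^{-2\pi i x\cdot m/N}$ for $m\in(\mathbb{Z}/N\mathbb{Z})^2$, where $x\cdot m=x_1m_1+x_2m_2$. *)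

(* Defs.v *)
From mathcomp Require Export all_boot all_order all_algebra.
From mathcomp Require Export complex.
From mathcomp Require Export reals exp trigo.

Set Implicit Arguments.
Unset Strict Implicit.
Unset Printing Implicit Defensive.

Import Order.TTheory GRing.Theory Num.Theory.

Local Open Scope ring_scope.

Definition squarefree (N : nat) : Prop := forall d : nat, (d ^ 2 %| N)%N -> d = 1%N.

(* Z/NZ is represented by its residues 'I_N rather than by 'Z_N, because       *)
(* 'Z_1 is Z/2Z and N = 1 must be allowed.                                     *)
Definition ord_sqr (N : nat) (t : 'I_N) : 'I_N :=
  Ordinal (ltn_pmod (t ^ 2) (leq_ltn_trans (leq0n t) (ltn_ord t))).

Definition parabola (N : nat) : {set 'I_N * 'I_N} :=
  [set (t, ord_sqr t) | t : 'I_N].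

(* The product is computed on representatives in nat; only its class mod N     *)
(* matters below, since expi (2 * pi * k / N) is N-periodic in the integer k.  *)
Definition dot (N : nat) (x m : 'I_N * 'I_N) : nat :=
  (x.1 * m.1 + x.2 * m.2)%N.

(* expi t = e^{i t} *)
Definition expi (R : realType) (t : R) : R[i] := Complex (cos t) (sin t).

Definition fourier (R : realType) (N : nat) (f : 'I_N * 'I_N -> R[i])
    (m : 'I_N * 'I_N) : R[i] :=
  N%:R^-1 * \sum_(x : 'I_N * 'I_N) f x * expi (- (2 * pi * (dot x m)%:R / N%:R)).

(* The complex modulus with values in R; `|z| would have type R[i].            *)
Definition cmod (R : realType) (z : R[i]) : R := complex.Re `|z|.

(* Main.v *)
Require Import Defs.
From mathcomp Require Import ring lra.

(* By Parseval applied to f ^ 2, the sum of |f|^4 is governed by the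
   convolution of \hat f with itself, whose value at m is a sum over the pairs
   (t, t') with t + t' = m_1 and t^2 + t'^2 = m_2. Modulo a prime these have at
   most two solutions; hence, by the Chinese remainder theorem for squarefree N,
   there are at most 2^omega(N) such pairs. Cauchy-Schwarz on each fiber gives
   the estimate with constant 2^(omega(N)/4) = O_eps(N^eps). *)

Set Implicit Arguments.
Unset Strict Implicit.
Unset Printing Implicit Defensive.

Import Order.TTheory GRing.Theory Num.Theory.

Local Open Scope ring_scope.

(** * Counting pairs of parabola points with a given sum *)

(** Each prime has exponent at most one in [N], so divisibility of the difference by [N] can be
    tested one prime at a time. *)
Lemma squarefree_eq_mod (N a b : nat) :
  (0 < N)%N -> squarefree N ->
  (forall p : nat, prime p -> p %| N -> a = b %[mod p])%N -> a = b %[mod N].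
Proof.
move=> N0 sf; wlog ba : a b / (b <= a)%N.
  move=> H ab; have [/H|/ltnW/H] := leqP b a; first exact.
  by move=> {}H; apply/esym/H => p pp pN; rewrite (ab p).
move=> ab; apply/eqP; rewrite eqn_mod_dvd //; apply/dvdn_partP => // p.
rewrite mem_primes => /and3P[pp _ pN]; rewrite p_part.
have : (logn p N <= 1)%N.
  rewrite leqNgt -pfactor_dvdn //; apply/negP => /sf p1.
  by rewrite p1 in pp.
case: (logn p N) => [|[|//]] _; first by rewrite expn0 dvd1n.
by rewrite expn1 -eqn_mod_dvd //; apply/eqP/ab.
Qed.

Lemma eqr_nat_Fp (p a b : nat) :
  prime p -> (a%:R == b%:R :> 'F_p) = (a == b %[mod p]).
Proof.
move=> pp; wlog ba : a b / (b <= a)%N.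
  move=> H; have [/H//|/ltnW/H] := leqP b a.
  by rewrite eq_sym => ->; rewrite eq_sym.
rewrite eqn_mod_dvd // -subr_eq0 -natrB //.
by rewrite -(dvdn_pcharf (pchar_Fp pp)).
Qed.

(** Eliminating [t'] turns the second equation into [2 * ((t - u) * (t - u')) = 0], and 2 is
    invertible for odd [p]. *)
Lemma parabola_fiber_Fp (p : nat) (t t' u u' : 'F_p) :
  prime p -> p != 2%N -> t + t' = u + u' -> t ^+ 2 + t' ^+ 2 = u ^+ 2 + u' ^+ 2 ->
  t = u \/ t = u'.
Proof.
move=> pp p2 e1 e2.
have : 2 * ((t - u) * (t - u')) = 0.
  have t'E : t' = u + u' - t by rewrite -e1; ring.
  have -> : 2 * ((t - u) * (t - u')) =
      t ^+ 2 + (u + u' - t) ^+ 2 - (u ^+ 2 + u' ^+ 2) by ring.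
  by rewrite t'E in e2; rewrite e2 subrr.
move/eqP; rewrite !mulf_eq0 !subr_eq0 => /or3P[|/eqP|/eqP]; [|by left|by right].
by rewrite -(dvdn_pcharf (pchar_Fp pp)) dvdn_prime2 // (negPf p2).
Qed.

(* (u, u') is a base point of the fiber. For odd p, t is u or u'; for p = 2, t is
   trivially u or u + 1. In both cases, whether t = u determines t mod p. *)
Lemma parabola_fiber_mod (p t t' s s' u u' : nat) :
  prime p ->
  (t + t' = u + u' %[mod p])%N -> (t ^ 2 + t' ^ 2 = u ^ 2 + u' ^ 2 %[mod p])%N ->
  (s + s' = u + u' %[mod p])%N -> (s ^ 2 + s' ^ 2 = u ^ 2 + u' ^ 2 %[mod p])%N ->
  (t == u %[mod p]) = (s == u %[mod p]) -> t = s %[mod p].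
Proof.
move=> pp /eqP t1 /eqP t2 /eqP s1 /eqP s2 tsu; have [p2|p2] := eqVneq p 2%N.
  by move: tsu; rewrite p2 !modn2; case: odd; case: odd; case: odd.
move: t1 t2 s1 s2 tsu; rewrite -!eqr_nat_Fp // !natrD !natrX.
move=> /eqP t1 /eqP t2 /eqP s1 /eqP s2 tsu; apply/eqP; rewrite -eqr_nat_Fp //.
move: tsu; have [->|->] := parabola_fiber_Fp pp p2 t1 t2;
  have [->|->] := parabola_fiber_Fp pp p2 s1 s2; rewrite ?eqxx => // /esym //.
by move/eqP => ->.
Qed.

(** Relative to a base pair [(u, u')], encode [q] by the set of primes modulo which [q.1] agrees
    with [u]. This set fixes [q.1] modulo every prime factor, hence fixes [q.1]; then the sum fixes
    [q.2]. The fiber thus embeds in the power set of the primes. *)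
Lemma card_parabola_fiber (n : nat) (m : 'I_n.+1 * 'I_n.+1) :
  squarefree n.+1 ->
  (#|[pred q : 'I_n.+1 * 'I_n.+1 |
       ((q.1, ord_sqr q.1) + (q.2, ord_sqr q.2))%R == m]|
   <= 2 ^ size (primes n.+1))%N.
Proof.
move=> sf; set A := [pred q | _].
have [[u u'] Au|A0] := pickP A; last by rewrite (eq_card0 A0).
have AE q : q \in A -> (q.1 + q.2 = u + u' %[mod n.+1])%N /\
    (q.1 ^ 2 + q.2 ^ 2 = u ^ 2 + u' ^ 2 %[mod n.+1])%N.
  move: Au; rewrite !inE => /eqP <- /eqP[].
  by rewrite !modnDm.
pose B (q : 'I_n.+1 * 'I_n.+1) : {set seq_sub (primes n.+1)} :=
  [set p | q.1 == u %[mod ssval p]].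
suff : {in A &, injective B}.
  move/leq_card_in; rewrite -cardsT -powersetT card_powerset cardsT.
  by rewrite card_seq_sub ?primes_uniq.
move=> [t t'] [s s'] /AE/=[t1 t2] /AE/=[s1 s2] /setP eB.
have ts : t = s.
  apply/val_inj; rewrite /= -(modn_small (ltn_ord t)) -(modn_small (ltn_ord s)).
  apply: squarefree_eq_mod => // p pp pN.
  have redp a b : a = b %[mod n.+1] -> a = b %[mod p].
    by move=> e; rewrite -(modn_dvdm a pN) e modn_dvdm.
  apply: (@parabola_fiber_mod p t t' s s' u u') => //; try exact: redp.
  have pP : p \in primes n.+1 by rewrite mem_primes pp.
  by have := eB (SeqSub pP); rewrite !inE.
congr (_, _) => //; apply/val_inj.
rewrite /= -(modn_small (ltn_ord t')) -(modn_small (ltn_ord s')).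
by apply/eqP; rewrite -(eqn_modDl t) {2}ts t1 s1.
Qed.

(** * Cauchy-Schwarz and Fourier analysis with a primitive root *)

Lemma sqr_norm_sum_le (F : numClosedFieldType) (I : finType) (A : pred I)
    (c : I -> F) :
  `|\sum_(i in A) c i| ^+ 2 <= #|A|%:R * \sum_(i in A) `|c i| ^+ 2.
Proof.
have /le_trans -> // : `|\sum_(i in A) c i| ^+ 2 <= (\sum_(i in A) `|c i|) ^+ 2.
  by rewrite ler_pXn2r ?nnegrE ?ler_norm_sum ?sumr_ge0.
(* After doubling, both sides are double sums, compared termwise by 2xy <= x^2 + y^2. *)
rewrite -(ler_pM2l (ltr0Sn F 1)).
rewrite expr2 big_distrlr /= mulr_sumr.
have -> : 2 * (#|A|%:R * \sum_(i in A) `|c i| ^+ 2) =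
    \sum_(i in A) \sum_(j in A) (`|c i| ^+ 2 + `|c j| ^+ 2).
  under [RHS]eq_bigr => i _ do rewrite big_split /= sumr_const.
  rewrite big_split /= sumr_const -sumrMnl mulr2n mulrDl mul1r mulr_natl.
  by rewrite sumrMnl.
apply: ler_sum => i _; rewrite mulr_sumr; apply: ler_sum => j _.
rewrite -subr_ge0.
have -> : `|c i| ^+ 2 + `|c j| ^+ 2 - 2 * (`|c i| * `|c j|) = (`|c i| - `|c j|) ^+ 2.
  by ring.
by rewrite real_exprn_even_ge0 // rpredB // normr_real.
Qed.

Lemma prim_root_conj (F : numClosedFieldType) (n : nat) (z : F) :
  n.-primitive_root z -> z^* = z^-1.
Proof.
move=> pz; have zn : `|z| = 1.
  apply/eqP; rewrite -(@pexpr_eq1 _ _ n) ?(prim_order_gt0 pz) //.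
  by rewrite -normrX (prim_expr_order pz) normr1.
by rewrite invC_norm zn expr1n invr1 mul1r.
Qed.

(** This is a geometric sum whose ratio [w] is an [n]-th root of unity, equal to 1 only if [a = b]
    because both are below [n]. *)
Lemma prim_root_orthogonal (F : numClosedFieldType) (n : nat) (z : F)
    (a b : 'I_n) :
  n.-primitive_root z ->
  \sum_(x < n) z ^+ (x * a) * (z ^+ (x * b))^* = n%:R * (a == b)%:R.
Proof.
move=> pz; have z0 : z != 0.
  apply: contra_eq_neq (prim_expr_order pz) => ->.
  by rewrite expr0n gtn_eqF ?(prim_order_gt0 pz) // eq_sym oner_eq0.
have zb0 : z ^+ b != 0 by rewrite expf_neq0.
pose w := z ^+ a / z ^+ b.
have -> : \sum_(x < n) z ^+ (x * a) * (z ^+ (x * b))^* = \sum_(x < n) w ^+ x.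
  apply: eq_bigr => x _; rewrite rmorphXn /= (prim_root_conj pz) exprVn.
  by rewrite mulnC exprM mulnC exprM -exprVn -exprMn.
have [ab|ab] := eqVneq a b.
  under eq_bigr => x _ do rewrite /w ab divff ?expf_neq0 // expr1n.
  by rewrite sumr_const card_ord mulr1.
have w1 : w - 1 != 0.
  rewrite subr_eq0; apply: contra ab => /eqP e.
  have : z ^+ a == z ^+ b by rewrite -[z ^+ a](divfK zb0) -/w e mul1r.
  by rewrite (eq_prim_root_expr pz) !modn_small.
apply/(mulfI w1); rewrite -subrX1 mulr0 mulr0 /w exprMn exprVn -!exprM.
by rewrite ![(_ * n)%N]mulnC !exprM (prim_expr_order pz) !expr1n divr1 subrr.
Qed.

(** For [z] a primitive [N]-th root of unity, these are the additive characters; keeping [z]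
    abstract makes the Fourier analysis purely algebraic. *)
Definition chi (F : nzRingType) (N : nat) (z : F) (x m : 'I_N * 'I_N) : F :=
  z ^+ dot x m.

Lemma chiC (F : nzRingType) (N : nat) (z : F) (x m : 'I_N * 'I_N) :
  chi z x m = chi z m x.
Proof. by rewrite /chi /dot [(x.1 * _)%N]mulnC [(x.2 * _)%N]mulnC. Qed.

Lemma chiD (F : comNzRingType) (n : nat) (z : F) (x m k : 'I_n.+1 * 'I_n.+1) :
  n.+1.-primitive_root z -> chi z x (m + k) = chi z x m * chi z x k.
Proof.
move=> pz; rewrite /chi /dot -exprD; apply/eqP.
rewrite (eq_prim_root_expr pz) /= -modnDm !modnMmr modnDm !mulnDr.
by rewrite addnACA.
Qed.

Lemma chi_orthogonal (F : numClosedFieldType) (N : nat) (z : F)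
    (m k : 'I_N * 'I_N) :
  N.-primitive_root z ->
  \sum_x chi z x m * (chi z x k)^* = N%:R ^+ 2 * (m == k)%:R.
Proof.
move=> pz; case: m k => [m1 m2] [k1 k2].
transitivity (\sum_(x1 < N) \sum_(x2 < N) (z ^+ (x1 * m1) * (z ^+ (x1 * k1))^*) *
    (z ^+ (x2 * m2) * (z ^+ (x2 * k2))^*)).
  rewrite pair_bigA; apply: eq_bigr => x _.
  by rewrite /chi /dot /= !exprD rmorphM /= mulrACA.
rewrite -big_distrlr /= !prim_root_orthogonal // xpair_eqE -mulnb natrM.
by rewrite mulrACA expr2.
Qed.

(** The frequencies [phi i] may repeat, so coefficients are first grouped by frequency. This allows
    one statement to serve both [f] and its square. *)
Lemma parseval (F : numClosedFieldType) (N : nat) (z : F) (I : finType)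
    (phi : I -> 'I_N * 'I_N) (c : I -> F) :
  N.-primitive_root z ->
  \sum_x `|\sum_i c i * chi z x (phi i)| ^+ 2 =
  N%:R ^+ 2 * \sum_m `|\sum_(i | phi i == m) c i| ^+ 2.
Proof.
move=> pz.
transitivity (\sum_x `|\sum_m (\sum_(i | phi i == m) c i) * chi z x m| ^+ 2).
  apply: eq_bigr => x _; congr (`|_| ^+ 2).
  rewrite (partition_big phi xpredT) //=; apply: eq_bigr => m _.
  by rewrite mulr_suml; apply: eq_bigr => i /eqP ->.
pose g m := \sum_(i | phi i == m) c i.
transitivity (\sum_x \sum_m \sum_k (g m * (g k)^*) * (chi z x m * (chi z x k)^*)).
  apply: eq_bigr => x _; rewrite normCK rmorph_sum big_distrlr /=.
  by apply: eq_bigr => m _; apply: eq_bigr => k _; rewrite rmorphM /= mulrACA.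
rewrite exchange_big mulr_sumr; apply: eq_bigr => m _ /=.
rewrite exchange_big (bigD1 m) //= [X in _ + X]big1 ?addr0 => [|k km].
  by rewrite -mulr_sumr chi_orthogonal // eqxx mulr1 normCK mulrC.
by rewrite -mulr_sumr chi_orthogonal // eq_sym (negPf km) !mulr0.
Qed.

(** * The fourth moment estimate, and Fourier inversion *)

Lemma extension_L4 (F : numClosedFieldType) (n : nat) (z : F)
    (a : 'I_n.+1 -> F) (f : 'I_n.+1 * 'I_n.+1 -> F) :
  n.+1.-primitive_root z -> squarefree n.+1 ->
  (forall x, f x = n.+1%:R^-1 * \sum_t a t * chi z x (t, ord_sqr t)) ->
  (n.+1%:R ^+ 2)^-1 * \sum_x `|f x| ^+ 4 <=
  2 ^+ size (primes n.+1) * ((n.+1%:R ^+ 2)^-1 * \sum_x `|f x| ^+ 2) ^+ 2.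
Proof.
move=> pz sf fE; set N := n.+1%:R.
have N0 : N != 0 :> F by rewrite pnatr_eq0.
have N20 : N ^+ 2 != 0 by rewrite expf_neq0.
have L2 : \sum_x `|f x| ^+ 2 = \sum_t `|a t| ^+ 2.
  transitivity (\sum_x N ^- 2 * `|\sum_t a t * chi z x (t, ord_sqr t)| ^+ 2).
    by apply: eq_bigr => x _; rewrite fE normrM exprMn normfV normr_nat exprVn.
  rewrite -mulr_sumr parseval // mulKf //.
  rewrite [RHS](partition_big (fun t => (t, ord_sqr t)) xpredT) //=.
  (* A point of the parabola determines its parameter, so each frequency carries at most one
     coefficient. *)
  apply: eq_bigr => m _; have [t tm|m0] := pickP (fun t => (t, ord_sqr t) == m).
    have e : (fun t => (t, ord_sqr t) == m) =1 pred1 t.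
      move=> s /=; apply/eqP/eqP => [|->]; last exact/eqP.
      by rewrite -(eqP tm) => -[].
    by rewrite !(big_pred1 t).
  by rewrite !big_pred0 // normr0 expr0n.
have L4 : \sum_x `|f x| ^+ 4 <=
    N ^- 2 * (2 ^+ size (primes n.+1) * (\sum_t `|a t| ^+ 2) ^+ 2).
  pose phi (q : 'I_n.+1 * 'I_n.+1) := (q.1, ord_sqr q.1) + (q.2, ord_sqr q.2).
  (* Here |f|^4 = |f^2|^2, and f^2 is an exponential sum over pairs [q] with frequency [phi q]. *)
  have -> : \sum_x `|f x| ^+ 4 =
      \sum_x N ^- 4 * `|\sum_q (a q.1 * a q.2) * chi z x (phi q)| ^+ 2.
    apply: eq_bigr => x _; rewrite (exprM _ 2 2) -normrX fE exprMn normrM.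
    rewrite exprMn normrX normfV normr_nat -exprM exprVn; congr (_ * `|_| ^+ 2).
    rewrite expr2 big_distrlr pair_bigA; apply: eq_bigr => q _ /=.
    by rewrite /phi chiD // mulrACA.
  rewrite -mulr_sumr parseval // mulrA.
  have -> : N ^- 4 * N ^+ 2 = N ^- 2 by rewrite (exprD _ 2 2) invfM divfK.
  rewrite ler_pM2l ?invr_gt0 ?exprn_gt0 ?ltr0Sn //.
  (* The right side is regrouped along the same fibers, so that Cauchy-Schwarz and the fiber count
     apply for each [m]. *)
  have -> : (\sum_t `|a t| ^+ 2) ^+ 2 = \sum_m \sum_(q | phi q == m) `|a q.1 * a q.2| ^+ 2.
    rewrite expr2 big_distrlr pair_bigA (partition_big phi xpredT) //=.
    by apply: eq_bigr => m _; apply: eq_bigr => q _; rewrite normrM exprMn.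
  rewrite mulr_sumr; apply: ler_sum => m _.
  apply: le_trans (sqr_norm_sum_le [pred q | phi q == m] _) _.
  rewrite ler_wpM2r ?sumr_ge0 // => [q _|]; first exact: exprn_ge0.
  by rewrite -natrX ler_nat card_parabola_fiber.
rewrite L2; apply: le_trans (ler_wpM2l _ L4) _; first by rewrite invr_ge0 exprn_ge0.
rewrite le_eqVlt; apply/orP; left; apply/eqP.
by rewrite exprMn [RHS]mulrCA (expr2 (N ^- 2)) !mulrA.
Qed.

(** In dimension two, orthogonality yields N^2, which cancels the two factors N^-1. *)
Lemma fourier_inversion (F : numClosedFieldType) (N : nat) (z : F)
    (f g : 'I_N * 'I_N -> F) :
  N.-primitive_root z ->
  (forall m, g m = N%:R^-1 * \sum_x f x * (chi z x m)^*) ->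
  forall x, f x = N%:R^-1 * \sum_m g m * chi z x m.
Proof.
move=> pz gE x.
have N0 : N%:R != 0 :> F by rewrite pnatr_eq0 -lt0n (prim_order_gt0 pz).
have -> : \sum_m g m * chi z x m =
    \sum_y N%:R^-1 * f y * \sum_m chi z m x * (chi z m y)^*.
  under [RHS]eq_bigr => y _ do rewrite mulr_sumr.
  rewrite exchange_big; apply: eq_bigr => m _ /=.
  rewrite gE mulr_sumr mulr_suml; apply: eq_bigr => y _.
  by rewrite (chiC z m x) (chiC z m y); ring.
rewrite (bigD1 x) //= [X in _ * (_ + X)]big1 ?addr0 => [|y yx]; rewrite chi_orthogonal //.
  by rewrite eqxx mulr1; field.
by rewrite eq_sym (negPf yx) !mulr0.
Qed.

(** * The complex exponential as a primitive root of unity *)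

Lemma expi0 (R : realType) : expi 0 = 1 :> R[i].
Proof. by rewrite /expi cos0 sin0. Qed.

Lemma expiD (R : realType) (s t : R) : expi (s + t) = expi s * expi t.
Proof.
rewrite /expi cosD sinD; apply/eqP.
by rewrite eq_complex /= eqxx; apply/eqP; ring.
Qed.

Lemma expiX (R : realType) (t : R) (k : nat) : expi t ^+ k = expi (t * k%:R).
Proof.
elim: k => [|k IH]; first by rewrite mulr0 expi0.
by rewrite exprSr IH -expiD -natr1 mulrDr mulr1.
Qed.

Lemma expiN (R : realType) (t : R) : expi (- t) = (expi t)^*.
Proof. by rewrite /expi cosN sinN. Qed.

(** The real part is 1 - 2 sin^2(t/2), and the sine is positive at t/2. *)
Lemma expi_neq1 (R : realType) (t : R) : 0 < t < 2 * pi -> expi t != 1.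
Proof.
move=> /andP[t0 tpi]; apply/negP => /eqP [c1 _].
have /sin_gt0_pi s0 : 0 < t / 2 < pi by lra.
have sq0 : 0 < sin (t / 2) ^+ 2 by rewrite exprn_gt0.
have e : t = (t / 2) *+ 2 by rewrite -mulr_natr divfK ?pnatr_eq0.
have := cos2Dsin2 (t / 2); rewrite e cos_mulr2n in c1; lra.
Qed.

Lemma expi_prim_root (R : realType) (N : nat) :
  (0 < N)%N -> N.-primitive_root (expi (2 * pi / N%:R) : R[i]).
Proof.
move=> N0; have NR : N%:R != 0 :> R by rewrite pnatr_eq0 -lt0n.
rewrite /primitive_root_of_unity N0; apply/forallP => i.
rewrite unity_rootE expiX; apply/eqP.
have [->|iN] := eqVneq i.+1 N.
  rewrite divfK // mulr_natl; apply/eqP.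
  by rewrite /expi cos2pi sin2pi.
apply/negbTE/expi_neq1; rewrite mulrAC; apply/andP; split.
  by rewrite !(mulr_gt0, invr_gt0, pi_gt0, ltr0n).
rewrite -mulrA gtr_pMr ?mulr_gt0 ?pi_gt0 //.
by rewrite ltr_pdivrMr ?ltr0n // mul1r ltr_nat ltn_neqAle iN ltn_ord.
Qed.

(** * The bound on 2^omega(N), and the conclusion over the reals *)

Lemma cmodE (R : realType) (x : R[i]) : real_complex R (cmod x) = `|x|.
Proof. by rewrite /cmod RRe_real // normr_real. Qed.

(* Primes p with 2 <= p ^ d contribute at most p ^ d to N ^ d; there are at
   most K exceptions. *)
Lemma pow2_primes_le (R : realType) (d : R) : 0 < d ->
  exists2 C : R, 0 < C &
    forall N : nat, (0 < N)%N -> 2 ^+ size (primes N) <= C * N%:R `^ d.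
Proof.
(* [K] exceeds 2^(1/d), so every prime p >= [K] satisfies 2 <= p^d. *)
move=> d0; pose K := Num.bound (2 `^ d^-1 : R).
exists (2 ^+ K) => [|N N0]; first by rewrite exprn_gt0.
have p_gt0 p : p \in primes N -> (0 < p)%N.
  by rewrite mem_primes => /and3P[/prime_gt0].
have powp1 p : p \in primes N -> 1 <= p%:R `^ d :> R.
  by move=> /p_gt0 p0; rewrite -[leLHS](powRr0 p%:R) ler_powR ?ler1n // ltW.
have -> : 2 ^+ size (primes N) = \prod_(p <- primes N) 2 :> R.
  by rewrite big_const_seq count_predT iter_mulr mulr1.
apply: (@le_trans _ _ (\prod_(p <- primes N) ((if p < K then 2 else 1)%N%:R * p%:R `^ d))).
  rewrite !big_seq; apply: ler_prod => p pP /=.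
  rewrite ler0n /=; case: ltnP => [_|Kp]; first by rewrite ler_peMr ?powp1.
  have -> : 2 = (2 `^ d^-1) `^ d :> R by rewrite -powRrM mulVf ?lt0r_neq0 ?powRr1.
  rewrite mul1r.
  rewrite ge0_ler_powR ?nnegrE ?powR_ge0 ?(ltW d0) //.
  by apply/ltW/(lt_le_trans (archi_boundP (powR_ge0 _ _))); rewrite ler_nat.
rewrite big_split /= ler_pM ?prodr_ge0 // => [p _||]; rewrite ?powR_ge0 //.
- rewrite -natr_prod -natrX ler_nat -big_mkcond /=.
  (* The distinct primes below [K] lie in [iota 0 K], hence at most [K] factors 2 occur. *)
  rewrite big_const_seq iter_muln muln1 leq_exp2l //.
  rewrite -size_filter -[leqRHS](size_iota 0) uniq_leq_size //.
    by rewrite filter_uniq ?primes_uniq.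
  by move=> p; rewrite mem_filter mem_iota => /andP[].
- have -> : \prod_(p <- primes N) p%:R `^ d = (\prod_(p <- primes N) p)%N%:R `^ d :> R.
    elim: (primes N) => [|p s IH]; first by rewrite !big_nil powR1.
    by rewrite !big_cons IH natrM powRM.
  rewrite ge0_ler_powR ?nnegrE ?ler_nat ?(ltW d0) //.
  (* The product of the prime factors is at most [N], since each occurs in [N] with exponent at
     least one. *)
  rewrite [leqRHS](prod_prime_decomp N0) prime_decompE big_map /=.
  rewrite !big_seq; apply: leq_prod => p; rewrite -logn_gt0 => l0.
  rewrite -[leqLHS]expn1 leq_pexp2l // p_gt0 //.
  by rewrite -logn_gt0.
Qed.

Lemma fourierE (R : realType) (N : nat) (f : 'I_N * 'I_N -> R[i]) m :
  fourier f m =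
  N%:R^-1 * \sum_x f x * (chi (expi (2 * pi / N%:R) : R[i]) x m)^*.
Proof.
rewrite /fourier; congr (_ * _); apply: eq_bigr => x _; congr (_ * _).
by rewrite expiN /chi expiX mulrAC.
Qed.

Lemma parabola_extension (R : realType) (N : nat) (f : 'I_N * 'I_N -> R[i]) :
  (0 < N)%N -> (forall m, m \notin parabola N -> fourier f m = 0) ->
  forall x, f x = N%:R^-1 * \sum_t fourier f (t, ord_sqr t) *
                  chi (expi (2 * pi / N%:R)) x (t, ord_sqr t).
Proof.
move=> N0 hf x.
rewrite (fourier_inversion (expi_prim_root R N0) (fourierE f)); congr (_ * _).
rewrite (bigID (mem (parabola N))) /= [X in _ + X]big1 ?addr0 => [|m /hf ->].
  rewrite big_imset /=; last by move=> s t _ _ [].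
  by apply: eq_bigl => t; rewrite inE.
by rewrite mul0r.
Qed.

Lemma extension_L4_cmod (R : realType) (N : nat) (f : 'I_N * 'I_N -> R[i]) :
  (0 < N)%N -> squarefree N ->
  (forall m, m \notin parabola N -> fourier f m = 0) ->
  (N%:R ^+ 2)^-1 * \sum_x cmod (f x) ^+ 4 <=
  2 ^+ size (primes N) * ((N%:R ^+ 2)^-1 * \sum_x cmod (f x) ^+ 2) ^+ 2.
Proof.
case: N f => // n f N0 sf hf.
(* The embedding of [R] into [R[i]] reflects the order, so the inequality is proved among complex
   numbers. *)
rewrite -lecR !(rmorphM, rmorphXn, fmorphV, rmorph_nat, rmorph_sum) /=.
under eq_bigr => x _ do rewrite rmorphXn /= cmodE.
under [in leRHS]eq_bigr => x _ do rewrite rmorphXn /= cmodE.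
exact: extension_L4 (expi_prim_root R N0) sf (parabola_extension N0 hf).
Qed.

Theorem theorem1p4 (R : realType) (eps : R) (heps : 0 < eps) :
  exists2 C : R, 0 < C &
    forall (N : nat) (hN : (0 < N)%N) (hsf : squarefree N)
           (f : 'I_N * 'I_N -> R[i])
           (hf : forall m : 'I_N * 'I_N, m \notin parabola N -> fourier f m = 0),
      ((N%:R ^+ 2)^-1 * \sum_(x : 'I_N * 'I_N) cmod (f x) ^+ 4) `^ (1 / 4)
      <= C * N%:R `^ eps *
         ((N%:R ^+ 2)^-1 * \sum_(x : 'I_N * 'I_N) cmod (f x) ^+ 2) `^ (1 / 2).
Proof.
(* The exponent is [4 * eps] because a fourth root is taken at the end. *)
have [C C0 HC] := pow2_primes_le (mulr_gt0 (ltr0Sn R 3) heps).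
exists (C `^ (1 / 4)) => [|N hN hsf f hf]; first exact: powR_gt0.
set A4 := (X in X `^ (1 / 4) <= _); set A2 := (X in _ <= _ * X `^ _).
have cmod_ge0 x : 0 <= cmod (f x) by rewrite -ler0c cmodE.
have A4_ge0 : 0 <= A4.
  by rewrite mulr_ge0 ?invr_ge0 ?exprn_ge0 ?sumr_ge0 // => x _; rewrite exprn_ge0.
have A2_ge0 : 0 <= A2.
  by rewrite mulr_ge0 ?invr_ge0 ?exprn_ge0 ?sumr_ge0 // => x _; rewrite exprn_ge0.
have A42 : A4 <= C * N%:R `^ (4 * eps) * A2 ^+ 2.
  apply: le_trans (extension_L4_cmod hN hsf hf) _.
  by rewrite ler_wpM2r ?exprn_ge0 ?HC.
clearbody A4 A2; rewrite -(powR_mulrn 2 A2_ge0) in A42.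
have -> : C `^ (1 / 4) * N%:R `^ eps * A2 `^ (1 / 2) =
    (C * N%:R `^ (4 * eps) * A2 `^ 2) `^ (1 / 4).
  rewrite !powRM ?mulr_ge0 ?powR_ge0 ?exprn_ge0 ?(ltW C0) //.
  rewrite -!powRrM; congr (_ * _ * _).
    by congr (_ `^ _); field.
  by congr (_ `^ _); field.
by rewrite ge0_ler_powR ?nnegrE ?divr_ge0 ?(le_trans A4_ge0 A42).
Qed.
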